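(* Let $n\ge 1$. Define polynomials $Q_k^{n+1}\in\mathbb{R}[x_1,x_2]$ of degree at most $n+1$ by $$Q_0^{n+1}(x_1,x_2)=T_{n+1}(x_1)-T_{n-1}(x_1),$$ and, for $1\le k\le n+1$, $$Q_k^{n+1}(x_1,x_2)=T_{n-k+1}(x_1)T_k(x_2)+T_{n-k+1}(x_2)T_{k-1}(x_1).$$ Then the set of Padua points $\mathrm{Pad}_n$ is the (real affine) variety of the ideal $I=\langle Q_0^{n+1},Q_1^{n+1},\ldots,Q_{n+1}^{n+1}\rangle$ of $\mathbb{R}[x_1,x_2]$. Furthermore, $$\operatorname{codim}(I)=|\mathrm{Pad}_n|=\dim\Pi_n^2 .$$
   Context: $T_m$ denotes the Chebyshev polynomial of the first kind, $T_m(\cos\theta)=\cos m\theta$. $\Pi_n^2$ is the space of real polynomials in two variables of total degree at most $n$; $\dim\Pi_n^2=(n+1)(n+2)/2$. For an ideal $I$ of $\mathbb{R}[x_1,x_2]$, its variety is $V(I)=\{\mathbf{x}\in\mathbb{R}^2: f(\mathbf{x})=0 \text{ for all } f\in I\}$, and $\operatorname{codim}(I)=\dim_{\mathbb{R}}(\mathbb{R}[x_1,x_2]/I)$. Padua points: for $n\ge1$, $$\mathrm{Pad}_n=\{\mathbf{x}_{k,j}=(\xi_k,\eta_j): 0\le k\le n,\ 1\le j\le \lfloor n/2\rfloor+1+\delta_k\},$$ where $\xi_k=\cos\frac{k\pi}{n}$; $\eta_j=\cos\frac{(2j-1)\pi}{n+1}$ if $k$ is even and $\eta_j=\cos\frac{(2j-2)\pi}{n+1}$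 if $k$ is odd (so $\eta_j$ depends also on the parity of $k$); and $\delta_k=1$ if $n$ and $k$ are both odd, $\delta_k=0$ otherwise. *)

(* Defs.v *)
From HB Require Import structures.
From mathcomp Require Import all_boot all_order all_algebra.
From mathcomp Require Import generic_quotient ring_quotient mpoly.
From mathcomp Require Import boolp classical_sets functions cardinality.
From mathcomp Require Import reals trigo ring.

Set Implicit Arguments.
Unset Strict Implicit.
Unset Printing Implicit Defensive.

Import Order.TTheory GRing.Theory Num.Theory.
Local Open Scope ring_scope.
Local Open Scope quotient_scope.

Definition has_dim (F : fieldType) (V : lmodType F) (d : nat) : Prop :=
  inhabited (Vector.axiom d V).

Section GeneratedIdeal.
Variables (K : nzRingType) (A : comAlgType K) (m : nat) (g : 'I_m -> A).

Definition ideal_gen : {pred A} :=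
  fun f => `[< exists a : 'I_m -> A, f = \sum_(i < m) a i * g i >].

Lemma ideal_gen_submod : submod_closed ideal_gen.
Proof.
split.
  by apply/asboolP; exists (fun=> 0); rewrite big1 // => i _; rewrite mul0r.
move=> c u v /asboolP[a ->] /asboolP[b ->]; apply/asboolP.
exists (fun i => c *: a i + b i).
rewrite scaler_sumr -big_split; apply: eq_bigr => i _ /=.
by rewrite mulrDl scalerAl.
Qed.

HB.instance Definition _ :=
  GRing.isSubmodClosed.Build K A ideal_gen ideal_gen_submod.

(* The library makes the quotient by an additive subgroup a Z-module only;
   here the scaling of [A] descends to it as well.  Its ring quotients are not
   used since they require the ideal to be proper. *)
Let Q := {ideal_quot ideal_gen}.

Definition quot_scale (a : K) : Q -> Q := lift_op1 Q ( *:%R a).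

Lemma pi_quot_scale (a : K) : {morph \pi_Q : x / a *: x >-> quot_scale a x}.
Proof.
move=> x; unlock quot_scale; apply/eqP; rewrite piE Quotient.equivE -scalerBr.
by apply: rpredZ; rewrite Quotient.idealrBE reprK.
Qed.

Let piD : {morph \pi_Q : x y / x + y} := Quotient.pi_add _.

Lemma quot_scaleA a b (x : Q) :
  quot_scale a (quot_scale b x) = quot_scale (a * b) x.
Proof. by rewrite -[x]reprK -!pi_quot_scale scalerA. Qed.

Lemma quot_scale1 : left_id 1 quot_scale.
Proof. by move=> x; rewrite -[x]reprK -pi_quot_scale scale1r. Qed.

Lemma quot_scaleDr : right_distributive quot_scale +%R.
Proof.
move=> a x y; rewrite -[x]reprK -[y]reprK -!piD -!pi_quot_scale.
by rewrite -piD scalerDr.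
Qed.

Lemma quot_scaleDl (x : Q) : {morph quot_scale^~ x : a b / a + b}.
Proof.
by move=> a b; rewrite /= -[x]reprK -!pi_quot_scale -piD scalerDl.
Qed.

HB.instance Definition _ := GRing.Zmodule_isLmodule.Build K {ideal_quot ideal_gen}
  quot_scaleA quot_scale1 quot_scaleDr quot_scaleDl.

End GeneratedIdeal.

Definition variety (K : comNzRingType) m (J : {pred {mpoly K[m]}}) :
  set 'rV[K]_m :=
  [set x | forall f, f \in J -> f.@[fun i => x ord0 i] = 0]%classic.

Section DegreeAtMost.
Variables (K : nzRingType) (m n : nat).

Definition deg_le : {pred {mpoly K[m]}} := fun p => (msize p <= n.+1)%N.

Lemma deg_le_submod : submod_closed deg_le.
Proof.
split; first by rewrite unfold_in msize0.
move=> c p q; rewrite !unfold_in => hp hq.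
rewrite (leq_trans (msizeD_le _ _)) // geq_max hq andbT.
exact: leq_trans (msizeZ_le _ _) hp.
Qed.

HB.instance Definition _ :=
  GRing.isSubmodClosed.Build K {mpoly K[m]} deg_le deg_le_submod.

Record poly_le := PolyLe { poly_le_val :> {mpoly K[m]}; _ : poly_le_val \in deg_le }.

HB.instance Definition _ := [isSub for poly_le_val].
HB.instance Definition _ := [Choice of poly_le by <:].
HB.instance Definition _ := [SubChoice_isSubLmodule of poly_le by <:].

End DegreeAtMost.

Section Chebyshev.
Variable R : realType.

(* Characterised by [chebT_cos] below. *)
Fixpoint chebT (m : nat) : {poly R} :=
  match m with
  | 0 => 1
  | S m1 => match m1 with
            | 0 => 'X
            | S m2 => ('X * chebT m1) *+ 2 - chebT m2
            end
  end.

Lemma chebT_cos (m : nat) (t : R) : (chebT m).[cos t] = cos (m%:R * t).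
Proof.
suff [] : (chebT m).[cos t] = cos (m%:R * t) /\
          (chebT m.+1).[cos t] = cos (m.+1%:R * t) by [].
elim: m => [|m [IH0 IH1]]; first by rewrite hornerC hornerX mul0r cos0 mul1r.
split=> //; rewrite [chebT m.+2]/= hornerD hornerN hornerMn hornerM hornerX.
rewrite -/(chebT m.+1) IH1 IH0.
have -> : m.+2%:R * t = m.+1%:R * t + t by rewrite -[m.+2]addn1 natrD mulrDl mul1r.
have -> : m%:R * t = m.+1%:R * t - t.
  by rewrite -[m.+1]addn1 natrD mulrDl mul1r addrK.
by rewrite cosB cosD; ring.
Qed.

Definition cheb_var (m : nat) (i : 'I_2) : {mpoly R[2]} :=
  horner_alg ('X_i : {mpoly R[2]}) (chebT m).

Lemma cheb_varSS m i :
  cheb_var m.+2 i = (('X_i : {mpoly R[2]}) * cheb_var m.+1 i) *+ 2 - cheb_var m i.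
Proof. by rewrite /cheb_var [chebT m.+2]/= rmorphB rmorphMn rmorphM /= horner_algX. Qed.

Lemma cheb_var_cos (m : nat) (i : 'I_2) (v : 'I_2 -> R) (t : R) :
  v i = cos t -> (cheb_var m i).@[v] = cos (m%:R * t).
Proof.
move=> vt; rewrite -chebT_cos.
suff [] : (cheb_var m i).@[v] = (chebT m).[cos t] /\
          (cheb_var m.+1 i).@[v] = (chebT m.+1).[cos t] by [].
elim: m => [|m [IH0 IH1]].
  by rewrite /cheb_var rmorph1 horner_algX meval1 mevalXU hornerC hornerX.
split=> //; rewrite cheb_varSS mevalB mevalMn mevalM mevalXU IH0 IH1 vt.
by rewrite [chebT m.+2]/= -/(chebT m.+1) hornerD hornerN hornerMn hornerM hornerX.
Qed.

Lemma msize_cheb_var_le (m : nat) (i : 'I_2) : (msize (cheb_var m i) <= m.+1)%N.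
Proof.
suff /andP[] : (msize (cheb_var m i) <= m.+1)%N &&
               (msize (cheb_var m.+1 i) <= m.+2)%N by [].
elim: m => [|m /andP[IH0 IH1]].
  by rewrite /cheb_var rmorph1 horner_algX msize1 msizeX mdeg1.
rewrite IH1 cheb_varSS; apply: leq_trans (msizeD_le _ _) _.
rewrite msizeN geq_max (leq_trans IH0) ?andbT; last by rewrite -addn2 leq_addr.
rewrite -scaler_nat; apply: leq_trans (msizeZ_le _ _) _.
have [->|nz] := eqVneq (cheb_var m.+1 i) 0; first by rewrite mulr0 msize0.
rewrite msizeM //; last by rewrite -msize_poly_eq0 msizeX.
by rewrite msizeX mdeg1.
Qed.

(* [T_(n - k + 1)] is written [n.+1 - k]: with truncated subtraction,
   [n - k + 1] would be wrong at [k = n + 1]. *)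
Definition paduaQ (n k : nat) : {mpoly R[2]} :=
  let T1 m := cheb_var m 0 in
  let T2 m := cheb_var m 1 in
  if k is 0 then T1 n.+1 - T1 n.-1
  else T1 (n.+1 - k)%N * T2 k + T2 (n.+1 - k)%N * T1 k.-1.

Lemma msize_paduaQ_le (n k : nat) :
  (k <= n.+1)%N -> (msize (paduaQ n k) <= n.+2)%N.
Proof.
have prod a b i j : (a + b <= n.+1)%N ->
    (msize (cheb_var a i * cheb_var b j) <= n.+2)%N.
  move=> ab; have [->|nza] := eqVneq (cheb_var a i) 0; first by rewrite mul0r msize0.
  have [->|nzb] := eqVneq (cheb_var b j) 0; first by rewrite mulr0 msize0.
  rewrite msizeM //; apply: leq_trans (_ : (a.+1 + b.+1).-1 <= _)%N.
    by rewrite -!subn1 leq_sub2r // leq_add ?msize_cheb_var_le.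
  by rewrite addSn addnS.
case: k => [|k] hk /=; apply: leq_trans (msizeD_le _ _) _; rewrite geq_max.
  rewrite msizeN msize_cheb_var_le (leq_trans (msize_cheb_var_le _ _)) //.
  by rewrite ltnS (leq_trans (leq_pred n)).
rewrite !prod ?subnK //; apply: leq_trans (_ : _ <= n.+1 - k.+1 + k.+1)%N _.
  by rewrite leq_add2l.
by rewrite subnK.
Qed.

Definition paduaI (n : nat) : {pred {mpoly R[2]}} :=
  ideal_gen (fun k : 'I_n.+2 => paduaQ n k).

Definition padua_xi (n k : nat) : R := cos (k%:R * pi / n%:R).

Definition padua_eta (n k j : nat) : R :=
  if odd k then cos ((2 * j%:R - 2) * pi / n.+1%:R)
  else cos ((2 * j%:R - 1) * pi / n.+1%:R).

Definition padua_delta (n k : nat) : nat := odd n && odd k.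

Definition Pad (n : nat) : set 'rV[R]_2 :=
  [set x | exists k j : nat,
     [/\ (k <= n)%N, (1 <= j <= n./2 + 1 + padua_delta n k)%N
       & x = \row_(i < 2) [:: padua_xi n k; padua_eta n k j]`_i]]%classic.

End Chebyshev.

Arguments paduaQ : clear implicits.
Arguments paduaI : clear implicits.
Arguments Pad : clear implicits.

(* Main.v *)
Require Import Defs.
From HB Require Import structures.
From mathcomp Require Import all_boot all_order all_algebra.
From mathcomp Require Import generic_quotient ring_quotient mpoly.
From mathcomp Require Import boolp classical_sets functions cardinality.
From mathcomp Require Import reals trigo.
From mathcomp Require Import zify ring.

Import Order.TTheory GRing.Theory Num.Theory.
Local Open Scope ring_scope.

Set Implicit Arguments.
Unset Strict Implicit.
Unset Printing Implicit Defensive.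

(** The Padua points are one half of the grid of the points
    [(cos (k pi / n), cos (l pi / (n + 1)))], [k <= n], [l <= n + 1], namely
    those with [k + l] odd.  Three facts about them and about the ideal [I]
    suffice; no system of equations has to be solved.

    - The generators vanish at the points ([paduaQ_grid_pt]): with
      [th = k pi / n] and [ph = l pi / (n + 1)], the relations [n th = k pi] and
      [(n + 1) ph = l pi] fold [cos ((n - i) th)] to [(-1)^k cos (i th)] and
      [cos ((n + 1 - i) ph)] to [(-1)^l cos (i ph)].  The two terms of [Q_i],
      [i >= 1], then differ only by the sign [(-1)^(k + l) = -1]; those of
      [Q_0] cancel because [cos ((n + 1) th) = cos ((n - 1) th)].

    - Every polynomial is congruent modulo [I] to one of degree at most [n]
      ([all_reducible]).  Up to degree [n], the generators are the products
      [T_(n + 1 - k)(x1) T_k(x2)], [0 <= k <= n + 1], so they eliminate all the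
      monomials of degree [n + 1]; multiplication by a variable can then be
      followed by reduction.

    - Both the number of points and the number of monomials of degree at most
      [n] are [N = (n + 1)(n + 2) / 2].  The half-turn
      [(k, l) |-> (n - k, n + 1 - l)] of the grid of pairs exchanges [k + l] odd
      with [k + l] even, and also [k + l <= n] with [k + l > n], so each of the
      two sets is half of the grid ([card_half_grid]).

    Evaluation at the [N] points is onto [R^N], by interpolation
    ([evals_surj]), and it factors through the quotient by [I], which is spanned
    by [N] monomials.  A linear map from a space spanned by [N] vectors onto
    [R^N] is bijective ([spanned_surj_bij]).  Applied to the quotient, this gives
    the codimension and shows that [I] consists of all the polynomials vanishing
    at the points; as a further point could be separated from these by a
    polynomial, the variety of [I] contains nothing else.  Applied to the
    polynomials of degree at most [n], which evaluation also maps onto [R^N] by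
    the second fact, it gives their dimension. *)

(** * Subsets of finite sets *)

Lemma enum_finset (T : finType) (A : {set T}) d : #|A| = d ->
  exists2 e : 'I_d -> T, injective e & forall x, x \in A <-> exists i, e i = x.
Proof.
move=> <-; exists (@enum_val T (mem A)); first exact: enum_val_inj.
move=> x; split=> [xA|[i <-]]; last exact: enum_valP.
by exists (enum_rank_in xA x); rewrite enum_rankK_in.
Qed.

Section HalfGrid.
Variables (a b : nat).
Let grid := ('I_a * 'I_b)%type.

Definition rev_grid (x : grid) : grid := (rev_ord x.1, rev_ord x.2).

Lemma rev_gridK : involutive rev_grid.
Proof. by case=> i j; rewrite /rev_grid /= !rev_ordK. Qed.

(** The half-turn exchanges [A] and its complement, so they have the same size. *)
Lemma card_half_grid (A : {set grid}) :
  (forall x, (rev_grid x \in A) = (x \notin A)) -> #|A| = ((a * b) %/ 2)%N.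
Proof.
move=> revA; have eqAC : #|~: A| = #|A|.
  rewrite -(card_imset A (can_inj rev_gridK)); apply: eq_card => x.
  rewrite !inE -[x in RHS]rev_gridK mem_imset ?revA //.
  exact: can_inj rev_gridK.
have := cardsC A; rewrite eqAC card_prod !card_ord => <-.
by rewrite addnn -muln2 mulnK.
Qed.

End HalfGrid.

(** * Spanning families and surjections *)

Section Spanning.
Variables (F : fieldType) (V : lmodType F) (d : nat).
Variables (b : 'I_d -> V) (E : {linear V -> 'rV[F]_d}).
Hypothesis b_span : forall v, exists u : 'rV[F]_d, v = \sum_i u ord0 i *: b i.
Hypothesis E_surj : forall w, exists v, E v = w.

(** In coordinates along [b], [E] is a square matrix [M] whose row space is
    everything; its inverse yields the inverse of [E]. *)
Lemma spanned_surj_bij : bijective E.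
Proof.
pose S (u : 'rV[F]_d) := \sum_i u ord0 i *: b i.
pose M := \matrix_i E (b i).
have ME u : E (S u) = u *m M.
  rewrite mulmx_sum_row linear_sum; apply: eq_bigr => i _.
  by rewrite linearZ rowK.
have Munit : M \in unitmx.
  rewrite -row_full_unit -sub1mx; apply/row_subP => i.
  have [v <-] := E_surj (row i 1%:M); have [u ->] := b_span v.
  by rewrite -/(S u) ME submxMl.
exists (fun w => S (w *m invmx M)) => [v|w]; last by rewrite ME mulmxKV.
by have [u ->] := b_span v; rewrite -/(S u) ME mulmxK.
Qed.

Lemma spanned_surj_has_dim : has_dim V d.
Proof. by constructor; exists E; [exact: linearP|exact: spanned_surj_bij]. Qed.

End Spanning.

(** * Interpolation at finitely many points *)

Section Interpolation.
Variables (K : fieldType) (m : nat).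

Definition evalrv (f : {mpoly K[m]}) (x : 'rV[K]_m) : K := f.@[fun i => x ord0 i].

(** A product of affine functions: each [y] in [s] differs from [x] in some
    coordinate [i], and ['X_i - y_i] vanishes at [y] but not at [x]. *)
Lemma separating_mpoly (s : seq 'rV[K]_m) (x : 'rV[K]_m) : x \notin s ->
  exists2 f : {mpoly K[m]}, evalrv f x = 1 & {in s, forall y, evalrv f y = 0}.
Proof.
elim: s => [|y s IHs]; first by exists 1; rewrite // /evalrv meval1.
rewrite inE negb_or => /andP[nxy /IHs[f fx fs]].
have [i nxyi] : exists i, x ord0 i != y ord0 i.
  apply/existsP; apply: contraNT nxy => /existsPn xy.
  by apply/eqP/rowP => i; apply/eqP/negPn/xy.
exists ((x ord0 i - y ord0 i)^-1 *: ('X_i - (y ord0 i)%:MP) * f).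
  rewrite /evalrv mevalM mevalZ mevalB mevalXU mevalC -/(evalrv f x) fx mulr1.
  by rewrite mulVf // subr_eq0.
move=> z; rewrite inE /evalrv mevalM mevalZ mevalB mevalXU mevalC.
by case/predU1P => [->|/fs]; rewrite ?subrr ?mulr0 ?mul0r // /evalrv => ->; rewrite mulr0.
Qed.

Definition evals d (p : 'I_d -> 'rV[K]_m) (f : {mpoly K[m]}) : 'rV[K]_d :=
  \row_i evalrv f (p i).

Lemma evals_is_linear d (p : 'I_d -> 'rV[K]_m) : linear (evals p).
Proof. by move=> c f g; apply/rowP => i; rewrite !mxE /evalrv mevalD mevalZ. Qed.

HB.instance Definition _ d (p : 'I_d -> 'rV[K]_m) :=
  GRing.isLinear.Build K {mpoly K[m]} 'rV[K]_d *:%R (evals p)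
    (evals_is_linear p).

(** Lagrange interpolation: [f i] is 1 at [p i] and 0 at the other points. *)
Lemma evals_surj d (p : 'I_d -> 'rV[K]_m) : injective p ->
  forall w, exists f, evals p f = w.
Proof.
move=> p_inj w.
have sep i : exists f : {mpoly K[m]}, forall j, evalrv f (p j) = (j == i)%:R.
  have [|f fi fs] := @separating_mpoly [seq p j | j <- enum 'I_d & j != i] (p i).
    apply/mapP => -[j]; rewrite mem_filter => /andP[ji _] /p_inj ij.
    by rewrite ij eqxx in ji.
  exists f => j; have [->//|ji] := eqVneq j i.
  by apply: fs; apply: map_f; rewrite mem_filter ji mem_enum.
have [f fE] := choice sep.
exists (\sum_i w ord0 i *: f i); apply/rowP => j; rewrite mxE /evalrv.
rewrite raddf_sum (bigD1 j) //= mevalZ [X in _ * X]fE eqxx mulr1 big1 ?addr0 //.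
by move=> i ij; rewrite mevalZ [X in _ * X]fE eq_sym (negPf ij) mulr0.
Qed.

End Interpolation.

(** * Ideals vanishing at as many points as span the quotient *)

Section GeneratedIdealTheory.
Variables (K : comNzRingType) (A : comAlgType K) (r : nat) (g : 'I_r -> A).

Lemma ideal_gen_gen k : g k \in ideal_gen g.
Proof.
apply/asboolP; exists (fun i => (i == k)%:R).
by rewrite (bigD1 k) //= eqxx mul1r big1 ?addr0 // => i /negPf->; rewrite mul0r.
Qed.

Lemma ideal_gen_mulr x y : x \in ideal_gen g -> x * y \in ideal_gen g.
Proof.
move=> /asboolP[c ->]; apply/asboolP; exists (fun k => y * c k).
by rewrite mulr_suml; apply: eq_bigr => k _; rewrite mulrAC [c k * y]mulrC.
Qed.

End GeneratedIdealTheory.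

Section IdealOfPoints.
Variables (K : fieldType) (m r d : nat) (g : 'I_r -> {mpoly K[m]}).
Let J := ideal_gen g.
Variables (p : 'I_d -> 'rV[K]_m) (b : 'I_d -> {mpoly K[m]}).
Hypothesis p_inj : injective p.
Hypothesis g_vanish : forall i k, evalrv (g k) (p i) = 0.
Hypothesis b_span :
  forall f, exists u : 'rV[K]_d, f - \sum_i u ord0 i *: b i \in J.

Lemma ideal_gen_vanish f i : f \in J -> evalrv f (p i) = 0.
Proof.
move=> /asboolP[c ->]; rewrite /evalrv raddf_sum big1 // => k _.
by rewrite /= mevalM [X in _ * X]g_vanish mulr0.
Qed.

Local Open Scope quotient_scope.
Let Q := {ideal_quot J}.

Definition quot_evals (x : Q) : 'rV[K]_d := evals p (repr x).

(** Evaluation does not depend on the representative of a class, since the ideal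
    vanishes at the points. *)
Lemma quot_evals_pi f : quot_evals (\pi_Q f) = evals p f.
Proof.
apply/eqP; rewrite -subr_eq0 -raddfB; apply/eqP/rowP => i.
by rewrite !mxE ideal_gen_vanish // Quotient.idealrBE reprK.
Qed.

Lemma pi_lin c f h : \pi_Q (c *: f + h) = c *: \pi_Q f + \pi_Q h.
Proof. by rewrite Quotient.pi_add pi_quot_scale. Qed.

Lemma quot_evals_is_linear : linear quot_evals.
Proof.
by move=> c x y; rewrite -[x]reprK -[y]reprK -pi_lin !quot_evals_pi linearP.
Qed.

HB.instance Definition _ :=
  GRing.isLinear.Build K Q 'rV[K]_d *:%R quot_evals quot_evals_is_linear.

Lemma quot_spanned x :
  exists u : 'rV[K]_d, x = \sum_i u ord0 i *: (\pi_Q (b i)).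
Proof.
have [u /[!Quotient.idealrBE]/eqP xu] := b_span (repr x).
exists u; rewrite -[LHS]reprK xu.
elim/big_rec2: _ => [|i y z _ <-]; last by rewrite pi_lin.
by have := pi_lin (-1) 0 0; rewrite scaler0 addr0 scaleN1r addNr.
Qed.

Lemma quot_evals_surj w : exists x, quot_evals x = w.
Proof.
by have [f <-] := evals_surj p_inj w; exists (\pi_Q f); rewrite quot_evals_pi.
Qed.

Lemma quot_has_dim : has_dim Q d.
Proof. exact: spanned_surj_has_dim quot_spanned quot_evals_surj. Qed.

(** The ideal is the kernel of evaluation, because evaluation is injective on the
    quotient. *)
Lemma vanish_ideal_gen f : (forall i, evalrv f (p i) = 0) -> f \in J.
Proof.
move=> f0; rewrite -[f]subr0 Quotient.idealrBE; apply/eqP.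
apply: (bij_inj (spanned_surj_bij quot_spanned quot_evals_surj)) => /=.
by rewrite !quot_evals_pi; apply/rowP => i; rewrite !mxE f0 /evalrv meval0.
Qed.

(** A polynomial that vanishes at the points [p i] but not at a further point [x]
    belongs to the ideal, so [x] is not in the variety. *)
Lemma variety_ideal_gen : variety J = range p.
Proof.
apply/seteqP; split=> [x xJ|_ [i _ <-] f fJ]; last exact: ideal_gen_vanish.
have [xp|/separating_mpoly[f fx fp]] := boolP (x \in [seq p i | i <- enum 'I_d]).
  by have /mapP[i _ ->] := xp; exists i.
have /xJ : f \in J by apply: vanish_ideal_gen => i; rewrite fp // map_f ?mem_enum.
by rewrite -/(evalrv f x) fx => /eqP; rewrite oner_eq0.
Qed.

End IdealOfPoints.

(** * Polynomials of bounded degree *)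

Section DegreeFiltration.
Variables (K : idomainType) (m : nat).
Implicit Types p q : {mpoly K[m]}.

(** As [msize] is the degree plus one, the asymmetric bounds let a strict degree
    bound [< a] on [p] and a weak one [<= b] on [q] combine to [< a + b]. *)
Lemma msizeM_leq p q a b : (msize p <= a)%N -> (msize q <= b.+1)%N ->
  (msize (p * q) <= a + b)%N.
Proof.
have [->|nzp] := eqVneq p 0; first by rewrite mul0r msize0.
have [->|nzq] := eqVneq q 0; first by rewrite mulr0 msize0.
by rewrite msizeM //; lia.
Qed.

Lemma msizeX_exp i a : (msize ('X_i ^+ a : {mpoly K[m]}) <= a.+1)%N.
Proof.
elim: a => [|a IHa]; first by rewrite expr0 msize1.
by rewrite exprS -[a.+2]/(2 + a)%N msizeM_leq // msizeX mdeg1.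
Qed.

End DegreeFiltration.

Section DegreeBasis.
Variables (K : fieldType) (n : nat).
Let N := ((n.+1 * n.+2) %/ 2)%N.

(** The monomials are indexed by ['I_N] through the pairs of exponents,
    which form the half [k + l <= n] of the grid. *)
Lemma deg_le_spanned : exists2 b : 'I_N -> {mpoly K[2]},
  forall i, b i \in deg_le n &
  forall f, f \in deg_le n ->
    exists u : 'rV[K]_N, f = \sum_i u ord0 i *: b i.
Proof.
pose A := [set x : 'I_n.+1 * 'I_n.+2 | (x.1 + x.2 <= n)%N].
have cardA : #|A| = N.
  by apply: card_half_grid => -[[i hi] [j hj]]; rewrite !inE /=; lia.
have [e e_inj eA] := enum_finset cardA.
pose mon (x : 'I_n.+1 * 'I_n.+2) : 'X_{1..2} :=
  [multinom nth 0%N [:: nat_of_ord x.1; nat_of_ord x.2] i | i < 2].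
have mon_deg x : mdeg (mon x) = (x.1 + x.2)%N.
  by rewrite mdegE !big_ord_recl big_ord0 !mnmE addn0.
have mon_inj : injective mon.
  move=> [i j] [i' j'] /mnmP E; congr (_, _); apply/val_inj.
    by have := E ord0; rewrite !mnmE.
  by have := E (lift ord0 ord0); rewrite !mnmE.
exists (fun i => 'X_[mon (e i)]) => [i|f].
  by have := (eA (e i)).2 (ex_intro _ i erefl); rewrite inE unfold_in msizeX mon_deg.
rewrite unfold_in => fn; exists (\row_i f@_(mon (e i))); apply/mpolyP => k.
rewrite raddf_sum /=.
have [kn|kn] := leqP (mdeg k) n.
  have Dk : mdeg k = (k ord0 + k (lift ord0 ord0))%N.
    by rewrite mdegE !big_ord_recl big_ord0 addn0.
  have k0 : (k ord0 < n.+1)%N by lia.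
  have k1 : (k (lift ord0 ord0) < n.+2)%N by lia.
  have /eA[i ei] : (Ordinal k0, Ordinal k1) \in A by rewrite inE /= -Dk.
  have <- : mon (e i) = k.
    apply/mnmP => j; rewrite ei mnmE.
    by case: (unliftP ord0 j) => [j'|] -> //; rewrite [j'](ord1 (j' : 'I_1)).
  rewrite (bigD1 i) //= mxE mcoeffZ mcoeffX eqxx mulr1 big1 ?addr0 // => j ji.
  by rewrite mxE mcoeffZ mcoeffX (inj_eq mon_inj) (inj_eq e_inj) (negPf ji) mulr0.
rewrite big1 => [|i _].
  by apply/eqP; rewrite mcoeff_eq0 msize_mdeg_ge // (leq_trans fn).
rewrite mcoeffZ mcoeffX; case: eqP => [ik|_]; last by rewrite mulr0.
have := (eA (e i)).2 (ex_intro _ i erefl).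
by rewrite inE -mon_deg ik leqNgt kn.
Qed.

End DegreeBasis.

(** * Reduction modulo the ideal of the Padua points *)

Section Padua.
Variables (R : realType) (n : nat).
Let N := ((n.+1 * n.+2) %/ 2)%N.

(** The Chebyshev polynomial has degree exactly [a], so a multiple of it has the
    same leading term as the power of the variable. *)
Lemma exp_cheb_var a i : exists c : R,
  (msize ('X_i ^+ a - c *: cheb_var R a i) <= a)%N.
Proof.
case: a => [|a].
  by exists 1; rewrite /cheb_var rmorph1 expr0 scale1r subrr msize0.
elim: a => [|a [c IHa]].
  by exists 1; rewrite /cheb_var horner_algX expr1 scale1r subrr msize0.
have [d cE] : exists d, c = d + d by exists (c / 2); rewrite -splitr.
(* The recurrence for [T_(a + 2)] doubles ['X T_(a + 1)], so [c] is halved. *)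
exists d; rewrite cheb_varSS.
have -> : 'X_i ^+ a.+2 - d *: ('X_i * cheb_var R a.+1 i *+ 2 - cheb_var R a i) =
    ('X_i ^+ a.+1 - c *: cheb_var R a.+1 i) * 'X_i + d *: cheb_var R a i.
  by rewrite cE -!mul_mpolyC mpolyCD !exprS; ring.
rewrite (leq_trans (msizeD_le _ _)) // geq_max -[a.+2]addn1 msizeM_leq //=.
  rewrite (leq_trans (msizeZ_le _ _)) //.
  by rewrite (leq_trans (msize_cheb_var_le _ _ _)) // addn1.
by rewrite msizeX mdeg1.
Qed.

Definition reducible f := exists2 g, g \in deg_le n & f - g \in paduaI R n.

Lemma deg_le_reducible f : f \in deg_le n -> reducible f.
Proof. by exists f; rewrite ?subrr ?rpred0. Qed.

Lemma ideal_reducible f : f \in paduaI R n -> reducible f.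
Proof. by exists 0; rewrite ?subr0 ?rpred0. Qed.

Lemma reducibleD f h : reducible f -> reducible h -> reducible (f + h).
Proof.
move=> [f' f'n fI] [h' h'n hI]; exists (f' + h'); first exact: rpredD.
by rewrite opprD addrACA rpredD.
Qed.

Lemma reducibleZ c f : reducible f -> reducible (c *: f).
Proof.
move=> [f' f'n fI]; exists (c *: f'); first exact: rpredZ.
by rewrite -scalerBr rpredZ.
Qed.

(** The product is the leading part of the generator [Q_k], whose other term has
    degree at most [n]. *)
Lemma cheb_prod_reducible k : (k <= n.+1)%N ->
  reducible (cheb_var R (n.+1 - k) 0 * cheb_var R k 1).
Proof.
move=> kn; set t := _ * _.
rewrite -[t](subrK (paduaQ R n k)); apply: reducibleD; last first.
  exact/ideal_reducible/(ideal_gen_gen _ (Ordinal (kn : (k < n.+2)%N))).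
apply: deg_le_reducible; rewrite unfold_in /t.
case: k kn @t => [|k] kn.
  rewrite /= subn0 {2}/cheb_var rmorph1 mulr1 opprB addrC subrK.
  by rewrite (leq_trans (msize_cheb_var_le _ _ _)) // ltnS leq_pred.
rewrite /= opprD addrA subrr add0r msizeN.
have /leq_trans-> // := msizeM_leq (msize_cheb_var_le R (n.+1 - k.+1) 1)
  (msize_cheb_var_le R k 0).
by lia.
Qed.

(** A monomial of degree [n + 1] agrees with a multiple of the corresponding
    product of Chebyshev polynomials up to terms of degree at most [n]. *)
Lemma degS_reducible f : (msize f <= n.+2)%N -> reducible f.
Proof.
move=> fn; rewrite [f]mpolyE big_seq; elim/big_ind: _ => [||k kf].
- by apply: deg_le_reducible; rewrite rpred0.
- exact: reducibleD.
apply: reducibleZ; have := leq_trans (msize_mdeg_lt kf) fn; rewrite ltnS.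
rewrite leq_eqVlt ltnS => /predU1P[kn|kn]; last first.
  by apply: deg_le_reducible; rewrite unfold_in msizeX.
move: kn; rewrite mpolyXE_id mdegE !big_ord_recl !big_ord0 addn0 mulr1.
have -> : lift ord0 ord0 = 1 :> 'I_2 by apply/val_inj.
have -> : ord0 = 0 :> 'I_2 by apply/val_inj.
move: (k 0) (k 1) => a b abn.
have [c Ha] := exp_cheb_var a 0; have [c' Hb] := exp_cheb_var b 1.
have -> : 'X_0 ^+ a * 'X_1 ^+ b =
    (c * c') *: (cheb_var R a 0 * cheb_var R b 1) +
    (('X_0 ^+ a - c *: cheb_var R a 0) * 'X_1 ^+ b +
     ('X_1 ^+ b - c' *: cheb_var R b 1) * (c *: cheb_var R a 0)) :> {mpoly R[2]}.
  rewrite -!mul_mpolyC mpolyCM; ring.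
apply: reducibleD.
  apply: reducibleZ; have bn : (b <= n.+1)%N by lia.
  by rewrite (_ : a = n.+1 - b)%N; [exact: cheb_prod_reducible|lia].
apply: deg_le_reducible; apply: rpredD; rewrite unfold_in.
  by rewrite -abn msizeM_leq ?msizeX_exp.
rewrite -abn addnC msizeM_leq //.
exact: leq_trans (msizeZ_le _ _) (msize_cheb_var_le _ _ _).
Qed.

Lemma reducibleXM i f : reducible f -> reducible ('X_i * f).
Proof.
move=> [g gn fI]; rewrite -[f](subrK g) mulrDr addrC; apply: reducibleD.
  by apply: degS_reducible; rewrite -[n.+2]/(2 + n)%N msizeM_leq // msizeX mdeg1.
by apply: ideal_reducible; rewrite mulrC ideal_gen_mulr.
Qed.

(** The reducible polynomials form a linear subspace containing [1] and closed
    under multiplication by the variables. *)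
Lemma all_reducible f : reducible f.
Proof.
elim/mpolyind: f => [|c k f _ _ IHf].
  by apply: deg_le_reducible; rewrite rpred0.
apply: reducibleD => //; apply: reducibleZ; rewrite mpolyXE_id.
elim/big_rec: _ => [|i f' _ IH].
  by apply: deg_le_reducible; rewrite unfold_in msize1.
by elim: (k i) => [|a IHa]; rewrite ?mul1r // exprS -mulrA; apply: reducibleXM.
Qed.

(** * The Padua points *)

Definition grid_pt (k l : nat) : 'rV[R]_2 :=
  \row_(i < 2) [:: cos (k%:R * pi / n%:R); cos (l%:R * pi / n.+1%:R)]`_i.

(** The pair [(k, j)] is sent to [(k, l)] with [l = 2 j - 2] if [k] is odd and
    [l = 2 j - 1] if it is even.  For odd [k], the correction by [padua_delta]
    lets [l] reach the end [n + 1] of the grid when this is even. *)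
Lemma Pad_grid : Pad R n =
  [set grid_pt x.1 x.2 | x in
    [set x | [/\ x.1 <= n, x.2 <= n.+1 & odd (x.1 + x.2)]%N]]%classic.
Proof.
apply/seteqP; split=> [_ [k [j [kn jn ->]]]|_ [[k l] [/= kn ln kl] <-]].
  pose l := if odd k then (2 * j - 2)%N else (2 * j - 1)%N.
  exists (k, l).
    by rewrite /padua_delta in jn; rewrite /l; split=> //=; case: ifP; lia.
  rewrite /grid_pt /= /padua_xi /padua_eta /l.
  by case: ifP => _; rewrite natrB ?natrM //; lia.
exists k, (l./2.+1); split=> //; first by rewrite /padua_delta; lia.
rewrite /grid_pt /= /padua_xi /padua_eta.
have lE : (l = 2 * l./2.+1 - (if odd k then 2 else 1))%N by case: ifP; lia.
by rewrite {1}lE; case: ifP => _; rewrite natrB ?natrM //; lia.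
Qed.

Lemma cosDnpi m (t : R) : cos (t + m%:R * pi) = (-1) ^+ m * cos t.
Proof.
elim: m => [|m IHm]; first by rewrite mul0r addr0 mul1r.
by rewrite -natr1 mulrDl mul1r addrA cosDpi IHm exprS mulN1r mulNr.
Qed.

Lemma cosBnpi m (t : R) : cos (m%:R * pi - t) = (-1) ^+ m * cos t.
Proof. by rewrite addrC cosDnpi cosN. Qed.

Hypothesis n_gt0 : (0 < n)%N.

(** Folding the cosines at [i pi] and [l pi] makes the two terms of [Q_k],
    [k >= 1], equal up to the signs [(-1)^i] and [(-1)^l], which are opposite.
    For [Q_0] only the folding at [i pi] enters. *)
Lemma paduaQ_grid_pt k i l : (k <= n.+1)%N -> odd (i + l) ->
  evalrv (paduaQ R n k) (grid_pt i l) = 0.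
Proof.
move=> kn il; rewrite /evalrv.
pose th : R := i%:R * pi / n%:R; pose ph : R := l%:R * pi / n.+1%:R.
have nth : n%:R * th = i%:R * pi by rewrite mulrC divfK // pnatr_eq0 -lt0n.
have nph : n.+1%:R * ph = l%:R * pi by rewrite mulrC divfK // pnatr_eq0.
have T1 a : (cheb_var R a 0).@[fun j => grid_pt i l ord0 j] = cos (a%:R * th).
  by apply: cheb_var_cos; rewrite mxE.
have T2 a : (cheb_var R a 1).@[fun j => grid_pt i l ord0 j] = cos (a%:R * ph).
  by apply: cheb_var_cos; rewrite mxE.
case: k kn => [|k] kn.
  rewrite mevalB !T1 -natr1 mulrDl mul1r nth [_ + th]addrC cosDnpi.
  by rewrite -subn1 natrB // mulrBl nth mul1r cosBnpi subrr.
rewrite mevalD !mevalM !T1 !T2.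
have -> : (n.+1 - k.+1)%:R * th = i%:R * pi - k%:R * th.
  by rewrite subSS natrB // mulrBl nth.
have -> : (n.+1 - k.+1)%:R * ph = l%:R * pi - k.+1%:R * ph.
  by rewrite natrB // mulrBl nph.
rewrite !cosBnpi -(signr_odd R i) -(signr_odd R l); move: il; rewrite oddD.
by case: (odd i); case: (odd l) => //= _; ring.
Qed.

Lemma cos_frac_inj d k k' : (0 < d)%N -> (k <= d)%N -> (k' <= d)%N ->
  cos (k%:R * pi / d%:R : R) = cos (k'%:R * pi / d%:R) -> k = k'.
Proof.
move=> d_gt0 kd k'd; have dR : 0 < d%:R :> R by rewrite ltr0n.
have pi0 : 0 < pi :> R by exact: pi_gt0.
have in0pi j : (j <= d)%N -> j%:R * pi / d%:R \in `[0, pi : R].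
  move=> jd; rewrite in_itv /= divr_ge0 ?mulr_ge0 ?ler0n ?(ltW pi0) //=.
  by rewrite ler_pdivrMr // mulrC ler_pM2l // ler_nat.
move/(cos_inj (in0pi _ kd) (in0pi _ k'd)) => /(mulIf (invr_neq0 (lt0r_neq0 dR))).
by move/(mulIf (lt0r_neq0 pi0))/eqP; rewrite eqr_nat => /eqP.
Qed.

Lemma Pad_enum : exists2 p : 'I_N -> 'rV[R]_2, injective p &
  Pad R n = range p /\
  forall i (k : 'I_n.+2), evalrv (paduaQ R n k) (p i) = 0.
Proof.
pose A := [set x : 'I_n.+1 * 'I_n.+2 | odd (x.1 + x.2)].
have cardA : #|A| = N.
  by apply: card_half_grid => -[[i hi] [j hj]]; rewrite !inE /=; lia.
have [e e_inj eA] := enum_finset cardA.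
exists (fun i => grid_pt (e i).1 (e i).2) => [i j /rowP E|].
  apply: e_inj; have := E 0; have := E 1; rewrite !mxE /=.
  case: (e i) (e j) => [[k hk] [l hl]] [[k' hk'] [l' hl']] /=.
  move=> /cos_frac_inj El /cos_frac_inj Ek.
  by congr (_, _); apply/val_inj => /=; [apply: Ek|apply: El].
split=> [|i k]; last first.
  rewrite paduaQ_grid_pt ?leq_ord //.
  by have := (eA (e i)).2 (ex_intro _ i erefl); rewrite inE.
rewrite Pad_grid; apply/seteqP; split=> [y [] | y []].
  move=> [k l] [/= kn ln kl] <-.
  pose x : 'I_n.+1 * 'I_n.+2 := (Ordinal (kn : k < n.+1), Ordinal (ln : l < n.+2))%N.
  have /eA[i ei] : x \in A by rewrite inE.
  by exists i; rewrite // ei.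
move=> i _ <-; exists ((e i).1 : nat, (e i).2 : nat) => //.
have := (eA (e i)).2 (ex_intro _ i erefl); rewrite inE => ?.
by split; rewrite //= leq_ord.
Qed.

End Padua.

Unset Implicit Arguments.

Theorem theorem2p3 (R : realType) (n : nat) (hn : (1 <= n)%N) :
  let N := ((n.+1 * n.+2) %/ 2)%N in
  [/\ variety (paduaI R n) = Pad R n,
      has_dim {ideal_quot (paduaI R n)} N,
      (Pad R n #= `I_N)%card
    & has_dim (poly_le R 2 n) N].
Proof.
move=> N; have [p p_inj [PadE Qp]] := Pad_enum R hn.
have [b bn b_span] := deg_le_spanned R n.
have span f : exists u : 'rV[R]_N, f - \sum_i u ord0 i *: b i \in paduaI R n.
  have [g /b_span[u gE] fgI] := all_reducible n f.
  by exists u; rewrite -gE.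
split.
- by rewrite PadE; apply: variety_ideal_gen p_inj Qp span.
- exact: quot_has_dim p_inj Qp span.
- rewrite PadE (card_eq_trans (inj_card_eq (in2W p_inj))) //.
  by rewrite card_eq_sym card_II.
pose E : {linear poly_le R 2 n -> 'rV[R]_N} := evals p \o val.
apply: (@spanned_surj_has_dim _ _ _ (fun i => PolyLe (bn i)) E) => [v|w].
  have [u vE] := b_span _ (valP v); exists u; apply/val_inj.
  by rewrite vE raddf_sum.
have [f <-] := evals_surj p_inj w.
have [g gn fgI] := all_reducible n f; exists (PolyLe gn).
apply/eqP; rewrite eq_sym -subr_eq0 -raddfB; apply/eqP/rowP => i.
by rewrite !mxE (ideal_gen_vanish Qp).
Qed.
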